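(* Let $\Xi \in \mathbb{Z}^{s\times s}$ be an expanding matrix, $a \in \ell_{00}(\mathbb{Z}^s)$, and let $S_a$ be the stationary subdivision operator with mask $a$ and scaling matrix $\Xi$. Suppose that the ideal $\langle a_\xi^* : \xi \in E_\Xi \rangle$ generated by the subsymbols of $a$ is zero dimensional with zeros $\Theta^{-1} = \{\theta^{-1}:\theta\in\Theta\}$, $\Theta \subset \mathbb{C}_\times^s$ finite, and respective multiplicity spaces $\mathcal{Q}_\theta$, $\theta \in \Theta$. Then $$ \ker S_a = \bigoplus_{\theta \in \Theta} \mathcal{P}_\theta \, e_\theta, \qquad \mathcal{P}_\theta := \sigma_- L^{-1}\sigma_\theta \mathcal{Q}_\theta . $$
   Context: Notation: $\mathbb{C}_\times^s := (\mathbb{C}\setminus\{0\})^s$; $\theta^{-1} := (\theta_1^{-1},\dots,\theta_s^{-1})$; $\ell(\mathbb{Z}^s)$ is the space of all functions $\mathbb{Z}^s \to \mathbb{C}$ and $\ell_{00}(\mathbb{Z}^s)$ its subspace of finitely supported functions. For $\theta \in \mathbb{C}_\times^s$, $e_\theta(\alpha) = \theta^\alpha = \theta_1^{\alpha_1}\cdots\theta_s^{\alpha_s}$, $\alpha \in \mathbb{Z}^s$. An expanding matrix $\Xi \in \mathbb{Z}^{s \times s}$ is one whose eigenvalues are all larger than one in modulus. The subdivision operator is $S_a c = \sum_{\alpha \in \mathbb{Z}^s} a(\cdot - \Xi\alpha)\, c(\alpha)$, $c \in \ell(\mathbb{Z}^s)$, and $\ker S_a = \{c \in \ell(\mathbb{Z}^s)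 : S_a c = 0\}$. $E_\Xi := \Xi[0,1)^s \cap \mathbb{Z}^s$ is a set of representatives of $\mathbb{Z}^s/\Xi\mathbb{Z}^s$. The subsymbols of $a$ are $a_\xi^*(z) = \sum_{\alpha \in \mathbb{Z}^s} a(\xi + \Xi\alpha) z^\alpha$, $\xi \in E_\Xi$, $z \in \mathbb{C}_\times^s$. $\Pi = \mathbb{C}[z_1,\dots,z_s]$. For $q = \sum_\alpha q_\alpha z^\alpha \in \Pi$ let $q(D) = \sum_\alpha q_\alpha \, \partial^{|\alpha|}/\partial z^\alpha$. A subspace $\mathcal{Q} \subseteq \Pi$ is $D$-invariant if $q(D)p \in \mathcal{Q}$ for all $p \in \mathcal{Q}$, $q \in \Pi$. For $\mathcal{P} \subseteq \Pi$, $\mathcal{P} e_\theta$ is the set of sequences $\alpha \mapsto p(\alpha)\theta^\alpha$, $p \in \mathcal{P}$. Ideals are taken in the ring of Laurent polynomials in $z_1,\dots,z_s$ over $\mathbb{C}$ (only zeros in $\mathbb{C}_\times^s$ count). Such an ideal $\mathcal{I}$ is zero dimensional with zeros $\Theta^{-1}$ and multiplicity spaces $\mathcal{Q}_\theta$ if $\Theta \subset \mathbb{C}_\times^s$ is finite, the $\mathcal{Q}_\theta$ are nonzero finite dimensional $D$-invariant subspaces of $\Pi$, and a Laurent polynomial $f$ belongs to $\mathcal{I}$ if and only if $(q(D)f)(\theta^{-1}) = 0$ for all $q \in \mathcal{Q}_\theta$, $\theta \in \Theta$. Operators on $\Pi$: $\Delta^\gamma$ is the forward difference operator with unit steps, $\Delta^0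 = I$, $\Delta^{\gamma+\epsilon_j} f = (\Delta^\gamma f)(\cdot+\epsilon_j) - \Delta^\gamma f$, $\epsilon_j$ the $j$th unit vector; $L f(x) = \sum_{|\gamma| \le \deg f} \frac{1}{\gamma!} \Delta^\gamma f(0)\, x^\gamma$, a linear bijection of $\Pi$; $\sigma_\theta f(z) = f(\theta_1 z_1,\dots,\theta_s z_s)$ and $\sigma_- f(z) = f(-z)$. *)

(* Defs.v *)
From HB Require Import structures.
From mathcomp Require Import all_boot all_order all_algebra.
From mathcomp Require Import finmap complex.
From mathcomp Require Import boolp classical_sets functions cardinality fsbigop.
From mathcomp Require Import reals.
From mathcomp Require Import monalg mpoly.

Set Implicit Arguments.
Unset Strict Implicit.
Unset Printing Implicit Defensive.

Import Order.TTheory GRing.Theory Num.Theory.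
Local Open Scope classical_set_scope.
Local Open Scope ring_scope.

(* monalg declares the same notation for its own polynomials. *)
Notation "{ 'mpoly' T [ n ] }" := (mpoly.mpoly n T) : type_scope.

(* The ring of Laurent polynomials in s variables, as the group algebra of the
   additive group Z^s: finitely supported coefficient families with the
   convolution product.  (monalg only provides the product when the exponents
   form a monoid without invertible elements, which excludes Z^s.) *)
Definition laurent (F : fieldType) (s : nat) := {malg F['cV[int]_s]}.

Section LaurentRing.
Context (F : fieldType) (s : nat).
Local Notation K := 'cV[int]_s.
Local Notation supp := (@monalg.msupp K F).
Local Notation coef := (@monalg.mcoeff K F).
Implicit Types (f g : laurent F s).

HB.instance Definition _ := GRing.Lmodule.on (laurent F s).

Definition lone : laurent F s := mkmalgU (0 : K) (1 : F).

Definition lmul f g : laurent F s :=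
  \sum_(k <- supp f) \sum_(l <- supp g) mkmalgU (k + l) (coef k f * coef l g).

Lemma lmulw (d1 d2 : {fset K}) f g :
  (supp f `<=` d1)%fset -> (supp g `<=` d2)%fset ->
  lmul f g =
    \sum_(k <- d1) \sum_(l <- d2) mkmalgU (k + l) (coef k f * coef l g).
Proof.
move=> le1 le2; rewrite /lmul (big_fset_incl _ le1) /=.
  apply/eq_bigr=> k1 _; apply/big_fset_incl => // k _ /mcoeff_outdom ->.
  by rewrite mulr0 monalgU0.
move=> k _ /mcoeff_outdom fk.
by rewrite big1 // => k' _; rewrite fk mul0r monalgU0.
Qed.

Lemma lmulC : commutative lmul.
Proof.
move=> f g; rewrite /lmul exchange_big /=.
by apply: eq_bigr => l _; apply: eq_bigr => k _; rewrite addrC mulrC.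
Qed.

Lemma lmul0g : left_zero 0 lmul.
Proof. by move=> g; rewrite /lmul monalg.msupp0 big_seq_fset0. Qed.

Lemma lmulUg c k g :
  lmul (mkmalgU k c) g = \sum_(l <- supp g) mkmalgU (k + l) (c * coef l g).
Proof.
rewrite (lmulw (monalg.msuppU_le) (fsubset_refl _)) big_seq_fset1.
by apply/eq_bigr => k' _; rewrite mcoeffUU.
Qed.

Lemma lmulUU c1 c2 k1 k2 :
  lmul (mkmalgU k1 c1) (mkmalgU k2 c2) = mkmalgU (k1 + k2) (c1 * c2).
Proof.
by rewrite (lmulw monalg.msuppU_le monalg.msuppU_le) !big_seq_fset1 !mcoeffUU.
Qed.

Lemma lmulEl f g :
  lmul f g = \sum_(k <- supp f) lmul (mkmalgU k (coef k f)) g.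
Proof. by apply/eq_bigr=> k _; rewrite lmulUg. Qed.

Lemma lmul1g : left_id lone lmul.
Proof.
move=> g; rewrite lmulUg [RHS]monalgE.
by apply/eq_bigr=> k _; rewrite mul1r add0r.
Qed.

Lemma lmulDl : left_distributive lmul +%R.
Proof.
move=> f1 f2 g.
rewrite [in RHS](lmulw (fsubsetUl _ (supp f2)) (fsubset_refl _)).
rewrite [in RHS](lmulw (fsubsetUr (supp f1) _) (fsubset_refl _)).
rewrite (lmulw (monalg.msuppD_le _ _) (fsubset_refl _)).
rewrite -big_split /=; apply/eq_bigr=> k1 _.
rewrite -big_split /=; apply/eq_bigr=> k2 _.
by rewrite monalg.mcoeffD mulrDl monalgUD.
Qed.

Lemma lmulA : associative lmul.
Proof.
have lmulDr g f1 f2 : lmul g (f1 + f2) = lmul g f1 + lmul g f2.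
  by rewrite ![lmul g _]lmulC lmulDl.
have lmulg0 g : lmul g 0 = 0 by rewrite lmulC lmul0g.
move=> g1 g2 g3.
rewrite [RHS](big_morph (lmul^~ _) (fun _ _ => lmulDl _ _ _) (lmul0g _)).
rewrite lmulEl; apply/eq_bigr=> k1 _.
rewrite [LHS](big_morph (lmul _) (fun _ _ => lmulDr _ _ _) (lmulg0 _)).
rewrite [RHS](big_morph (lmul^~ _) (fun _ _ => lmulDl _ _ _) (lmul0g _)).
apply/eq_bigr=> k2 _.
rewrite [LHS](big_morph (lmul _) (fun _ _ => lmulDr _ _ _) (lmulg0 _)).
rewrite [RHS]lmulC lmulEl; apply/eq_bigr=> k3 _.
by rewrite [RHS]lmulC !lmulUU mulrA addrA.
Qed.

Lemma lone_neq0 : lone != 0.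
Proof. by rewrite monalgU_eq0 oner_eq0. Qed.

HB.instance Definition _ := GRing.Zmodule_isComNzRing.Build (laurent F s)
  lmulA lmulC lmul1g lmulDl lone_neq0.

End LaurentRing.

Section Defs.
Context (F : fieldType) (s : nat).
Local Notation K := 'cV[int]_s.
Implicit Types (f : laurent F s) (p q : {mpoly F[s]}) (theta z : 'cV[F]_s).

(* z^k = z_1^k_1 ... z_s^k_s ; as a function of k this is the sequence e_z. *)
Definition zpow z (k : K) : F := \prod_(j < s) z j 0 ^ k j 0.

Definition vinv theta : 'cV[F]_s := \col_j (theta j 0)^-1.

Definition leval f z : F :=
  \sum_(k <- monalg.msupp f) monalg.mcoeff k f * zpow z k.

(* d/dz_j sends z^k to k_j z^(k - e_j). *)
Definition lderiv (j : 'I_s) f : laurent F s :=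
  \sum_(k <- monalg.msupp f)
    mkmalgU (k - delta_mx j 0) (monalg.mcoeff k f * (k j 0)%:~R).

Definition lderivm (m : 'X_{1..s}) f : laurent F s :=
  foldr (fun j g => iter (m j) (lderiv j) g) f (enum 'I_s).

(* The differential operator q(D), on Laurent polynomials and on polynomials. *)
Definition lopD q f : laurent F s := \sum_(m <- msupp q) q@_m *: lderivm m f.
Definition opD q p : {mpoly F[s]} := \sum_(m <- msupp q) q@_m *: p^`M[m].

Definition D_invariant (Q : set {mpoly F[s]}) :=
  forall p q, Q p -> Q (opD q p).

Definition sigma theta p : {mpoly F[s]} :=
  p \mPo [tuple theta j 0 *: 'X_j | j < s].
Definition sigma_minus p : {mpoly F[s]} := p \mPo [tuple - 'X_j | j < s].

Definition fdiff (j : 'I_s) p : {mpoly F[s]} :=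
  p \mPo [tuple 'X_i + (i == j)%:R | i < s] - p.
Definition fdiffm (m : 'X_{1..s}) p : {mpoly F[s]} :=
  foldr (fun j g => iter (m j) (fdiff j) g) p (enum 'I_s).

(* The multi-indices of 'X_{1..s < msize p} are those of length <= deg p. *)
Definition Lop p : {mpoly F[s]} :=
  \sum_(m : 'X_{1..s < msize p})
    ((\prod_(j < s) (m j)`!)%:R^-1 * (fdiffm m p).@[fun=> 0]) *: 'X_[m].

(* sigma_- L^-1 sigma_theta Q ; since Lop is bijective in characteristic 0,
   the image of a set under its inverse is its preimage under Lop. *)
Definition Pspace theta (Q : set {mpoly F[s]}) : set {mpoly F[s]} :=
  sigma_minus @` (Lop @^-1` (sigma theta @` Q)).

Definition exp_poly theta (P : set {mpoly F[s]}) : set (K -> F) :=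
  [set (fun alpha : K => p.@[fun j => (alpha j 0)%:~R] * zpow theta alpha)
     | p in P].

(* a is the coefficient family of the mask; both sums have finite support when
   a does and Xi is nonsingular. *)
Definition subdivision (Xi : 'M[int]_s) (a c : K -> F) : K -> F :=
  fun beta => \sum_(alpha \in [set: K]) a (beta - Xi *m alpha) * c alpha.
Definition ker_subdivision (Xi : 'M[int]_s) (a : K -> F) : set (K -> F) :=
  [set c | subdivision Xi a c = 0].
Definition subsymbol (Xi : 'M[int]_s) (a : K -> F) (xi : K) : laurent F s :=
  \sum_(alpha \in [set: K])
    (mkmalgU alpha (a (xi + Xi *m alpha)) : laurent F s).

End Defs.

Definition finitely_supported (T : Type) (V : zmodType) (a : T -> V) :=
  finite_set [set x | a x != 0].

Definition is_ideal (A : comNzRingType) (J : set A) :=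
  [/\ J 0, forall f g, J f -> J g -> J (f + g)
    & forall h f, J f -> J (h * f)].
Definition ideal_gen (A : comNzRingType) (G : set A) : set A :=
  smallest (@is_ideal A) G.

Definition finite_dim_subspace (F : fieldType) (V : lmodType F) (Q : set V) :=
  exists (n : nat) (b : 'I_n -> V),
    Q = [set \sum_(i < n) c i *: b i | c in [set: 'I_n -> F]].

Definition zero_dim_with (F : fieldType) (s : nat) (J : set (laurent F s))
    (Theta : {fset 'cV[F]_s}) (Q : 'cV[F]_s -> set {mpoly F[s]}) :=
  [/\ forall theta, theta \in Theta -> forall j, theta j 0 != 0,
      forall theta, theta \in Theta ->
        [/\ finite_dim_subspace (Q theta), exists2 q, Q theta q & q != 0
          & D_invariant (Q theta)]
    & forall f, J f <->
        forall theta q, theta \in Theta -> Q theta q ->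
          leval (lopD q f) (vinv theta) = 0].

(* W is the internal direct sum of the U i, i in A. *)
Definition is_direct_sum (V : zmodType) (I : choiceType) (A : {fset I})
    (U : I -> set V) (W : set V) :=
  W = [set \sum_(i <- A) u i
         | u in [set u : I -> V | forall i, i \in A -> U i (u i)]] /\
  forall u : I -> V, (forall i, i \in A -> U i (u i)) ->
    \sum_(i <- A) u i = 0 -> forall i, i \in A -> u i = 0.

Definition expanding (R : realType) (s : nat) (Xi : 'M[int]_s) :=
  forall l : R[i],
    eigenvalue (map_mx intr Xi : 'M[R[i]]_s) l -> 1 < `|l|.

(* Xi [0,1)^s `&` Z^s *)
Definition E_set (R : realType) (s : nat) (Xi : 'M[int]_s) :
    set 'cV[int]_s :=
  [set xi | exists2 x : 'cV[R]_s, forall j, 0 <= x j 0 < 1 &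
     map_mx intr xi = map_mx intr Xi *m x].

(* Main.v *)
(* Pair a sequence c with a Laurent polynomial f = sum_k f_k z^k by
   <c, f> = sum_k f_k c(-k).  Convolving with the subsymbols shows that ker S_a
   is the annihilator of the ideal J they generate.  The functional
   f |-> (q(D) f)(theta^-1) is the pairing with p e_theta for
   p = sigma_- L^-1 sigma_theta q, because L^-1 sends monomials to falling
   factorials, which are the factors produced by differentiating z^k.  So J is
   the common kernel of the finite-dimensional space W spanned by these
   p e_theta, and its annihilator is W itself.  The sum is direct since
   p e_theta is killed by a power of every (shift along e_j) - theta_j, and for
   theta <> theta' some coordinate gives coprime operators. *)

From HB Require Import structures.
Require Import Defs.
From mathcomp Require Import all_boot all_order all_algebra.
From mathcomp Require Import finmap complex.
From mathcomp Require Import boolp classical_sets functions cardinality fsbigop.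
From mathcomp Require Import reals.
From mathcomp Require Import ssrcomplements mpoly.
From mathcomp Require Import ring.

Import Order.TTheory GRing.Theory Num.Theory.
Set Implicit Arguments.
Unset Strict Implicit.
Unset Printing Implicit Defensive.

Local Open Scope classical_set_scope.
Local Open Scope ring_scope.

(** * Falling factorials, Newton expansion and the inverse of L *)

Section Newton.
Context {F : fieldType} {s : nat}.
Implicit Types (p q r : {mpoly F[s]}) (m k : 'X_{1..s}) (j : 'I_s).

(** Linear extension from the monomial basis, so that identities for [newton] and [eseq] reduce to
    monomials. *)
Definition mlin {V : lmodType F} (G : 'X_{1..s} -> V) r : V :=
  \sum_(m <- msupp r) r@_m *: G m.

Lemma mlinw {V : lmodType F} (G : 'X_{1..s} -> V) r n :
  (msize r <= n)%N -> mlin G r = \sum_(m : 'X_{1..s < n}) r@_m *: G m.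
Proof.
move=> le_rn; pose I : subFinType _ := 'X_{1..s < n}.
rewrite /mlin (big_mksub I) ?msupp_uniq //=; last first.
  by move=> m /msize_mdeg_lt /leq_trans; apply.
by rewrite big_rmcond //= => m /memN_msupp_eq0 ->; rewrite scale0r.
Qed.

Lemma mlin_is_linear {V : lmodType F} (G : 'X_{1..s} -> V) : linear (mlin G).
Proof.
move=> c p q.
pose n := maxn (msize (c *: p + q)) (maxn (msize p) (msize q)).
rewrite !(@mlinw _ _ _ n) ?leq_max ?leqnn ?orbT // scaler_sumr -big_split /=.
by apply: eq_bigr => m _; rewrite mcoeffD mcoeffZ scalerDl scalerA.
Qed.

HB.instance Definition _ {V : lmodType F} (G : 'X_{1..s} -> V) :=
  GRing.isLinear.Build F {mpoly F[s]} V *:%R (mlin G) (mlin_is_linear G).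

Lemma mlinX {V : lmodType F} (G : 'X_{1..s} -> V) m : mlin G 'X_[m] = G m.
Proof. by rewrite /mlin msuppX big_seq1 mcoeffX eqxx scale1r. Qed.

Lemma raddf_mlin {V W : lmodType F} (f : {linear V -> W}) G r :
  f (mlin G r) = mlin (fun m => f (G m)) r.
Proof. by rewrite /mlin linear_sum; apply: eq_bigr => m _; rewrite linearZ. Qed.

Lemma eq_mlin {V : lmodType F} (G G' : 'X_{1..s} -> V) r :
  G =1 G' -> mlin G r = mlin G' r.
Proof. by move=> eqG; apply: eq_bigr => m _; rewrite eqG. Qed.

Definition falling {A : pzRingType} (x : A) n : A := \prod_(i < n) (x - i%:R).

Lemma fallingSr {A : comPzRingType} (x : A) n :
  falling x n.+1 = falling x n * (x - n%:R).
Proof. by rewrite /falling big_ord_recr. Qed.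

Lemma fallingSl {A : comPzRingType} (x : A) n :
  falling (x + 1) n.+1 = (x + 1) * falling x n.
Proof.
rewrite /falling big_ord_recl subr0; congr (_ * _).
by apply: eq_bigr => i _; rewrite /= natrD opprD addrA addrK.
Qed.

(** The discrete counterpart of the derivative of x^n: both terms on the left share the factor
    [falling x n.-1]. For n = 0 the right side vanishes through [n%:R]. *)
Lemma falling_diff {A : comPzRingType} (x : A) n :
  falling (x + 1) n - falling x n = n%:R * falling x n.-1.
Proof.
case: n => [|n]; first by rewrite /falling !big_ord0 subrr mul0r.
by rewrite fallingSl fallingSr -natr1; ring.
Qed.

Lemma falling0 {A : comPzRingType} n : falling (0 : A) n = (n == 0%N)%:R.
Proof.
case: n => [|n]; first by rewrite /falling big_ord0.
by rewrite /falling big_ord_recl subr0 mul0r.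
Qed.

Lemma rmorph_falling {A B : comPzRingType} (f : {rmorphism A -> B}) x n :
  f (falling x n) = falling (f x) n.
Proof.
by rewrite rmorph_prod; apply: eq_bigr => i _; rewrite rmorphB rmorph_nat.
Qed.

(** These products play for the differences the role that monomials play for derivatives. *)
Definition fallmon m : {mpoly F[s]} := \prod_(j < s) falling 'X_j (m j).

Lemma meval_fallmon m (v : 'I_s -> F) :
  (fallmon m).@[v] = \prod_(j < s) falling (v j) (m j).
Proof.
rewrite rmorph_prod; apply: eq_bigr => j _ /=.
by rewrite rmorph_falling /= mevalXU.
Qed.

Lemma meval0_fallmon m : (fallmon m).@[fun=> 0] = (m == 0%MM)%:R.
Proof.
rewrite meval_fallmon; case: eqP => [->|/eqP m0].
  by rewrite big1 // => j _; rewrite mnmE falling0.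
have [j mj0] : exists j, m j != 0%N.
  apply/existsP; apply: contraNT m0 => /existsPn m0.
  by apply/eqP/mnmP => j; rewrite mnmE; apply/eqP; rewrite -[_ == _]negbK m0.
by rewrite (bigD1 j) //= falling0 (negbTE mj0) mul0r.
Qed.

Lemma fdiff_is_linear j : linear (@fdiff F s j).
Proof. by move=> c p q; rewrite /fdiff linearP /= scalerBr addrACA opprD. Qed.

HB.instance Definition _ j :=
  GRing.isLinear.Build F {mpoly F[s]} {mpoly F[s]} *:%R (@fdiff F s j)
    (fdiff_is_linear j).

Lemma fdiff_fallmon j m :
  fdiff j (fallmon m) = (m j)%:R *: fallmon (m - U_(j))%MM.
Proof.
rewrite /fdiff rmorph_prod /= (bigD1 j) //= [X in _ - X](bigD1 j) //=.
have shiftE i : falling 'X_i (m i) \mPo [tuple 'X_i + (i == j)%:R | i < s] =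
    falling ('X_i + (i == j)%:R) (m i) :> {mpoly F[s]}.
  by rewrite rmorph_falling /= comp_mpolyXU nth_mktuple.
rewrite shiftE eqxx.
rewrite (eq_bigr (fun i => falling 'X_i (m i))); last first.
  by move=> i ij; rewrite shiftE (negbTE ij) addr0.
rewrite -mulrBl falling_diff /fallmon [in RHS](bigD1 j) //= -mulrA mulr_natl.
rewrite mnmBE mnm1E eqxx subn1 scaler_nat; congr ((_ * _) *+ _).
by apply: eq_bigr => i ij; rewrite mnmBE mnm1E eq_sym (negbTE ij) subn0.
Qed.

(** Truncated subtraction in the exponent is harmless: once n exceeds [m j], the coefficient
    [m j ^_ n] is zero. *)
Lemma iter_fdiff_fallmon n j m :
  iter n (fdiff j) (fallmon m) =
  (m j ^_ n)%:R *: fallmon [multinom (m i - (i == j) * n)%N | i < s].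
Proof.
elim: n => [|n IHn].
  rewrite ffactn0 scale1r /=; congr fallmon.
  by apply/mnmP => i; rewrite mnmE muln0 subn0.
rewrite iterS IHn linearZ /= fdiff_fallmon scalerA -natrM ffactnSr.
rewrite !mnmE eqxx mul1n; congr (_ *: fallmon _); apply/mnmP => i.
by rewrite !mnmE -subnDA mulnS [in RHS]addnC eq_sym.
Qed.

Lemma fdiffm_fallmon k m :
  fdiffm k (fallmon m) =
  (\prod_(j < s) (m j ^_ k j))%:R *: fallmon (m - k)%MM.
Proof.
(* The iterated differences are taken one coordinate at a time; only the exponents of coordinates
   already in [l] have been lowered. *)
have fdiffm_on l : uniq l ->
    foldr (fun j g => iter (k j) (fdiff j) g) (fallmon m) l =
    (\prod_(j <- l) (m j ^_ k j))%:R *: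
      fallmon [multinom (m i - (i \in l) * k i)%N | i < s].
  elim: l => [_|j l IHl /= /andP[jl /IHl ->]].
    rewrite big_nil scale1r; congr fallmon.
    by apply/mnmP => i; rewrite mnmE subn0.
  have -> n (c : F) p : iter n (fdiff j) (c *: p) = c *: iter n (fdiff j) p.
    by elim: n => // n IHn; rewrite !iterS IHn linearZ.
  rewrite iter_fdiff_fallmon big_cons scalerA -natrM mulnC !mnmE.
  rewrite (negbTE jl) subn0; congr (_ *: fallmon _); apply/mnmP => i.
  rewrite !mnmE inE -subnDA; congr (_ - _)%N.
  by case: eqP => [->|_]; rewrite ?(negbTE jl) ?addn0.
rewrite /fdiffm fdiffm_on ?enum_uniq // big_enum /=; congr (_ *: fallmon _).
by apply/mnmP => i; rewrite !mnmE mem_enum mul1n.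
Qed.

(** This is L^-1: by Newton's interpolation formula, L turns the falling factorial expansion of a
    polynomial into the monomial one. *)
Definition newton : {mpoly F[s]} -> {mpoly F[s]} := mlin fallmon.

Lemma fdiffm_is_linear k : linear (@fdiffm F s k).
Proof.
move=> c p q; rewrite /fdiffm; elim: (enum _) => // j l /= ->.
elim: (k j) => // n IHn.
by rewrite !iterS IHn linearP.
Qed.

HB.instance Definition _ k :=
  GRing.isLinear.Build F {mpoly F[s]} {mpoly F[s]} *:%R (@fdiffm F s k)
    (fdiffm_is_linear k).

(** Up to the factorials, the functionals taking the difference of order k at 0 are dual to the
    falling factorials, so they read off the coefficients of [r]. *)
Lemma meval0_fdiffm_newton k r :
  (fdiffm k (newton r)).@[fun=> 0] = (\prod_(j < s) (k j)`!)%:R * r@_k.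
Proof.
have diag m : (fdiffm k (fallmon m)).@[fun=> 0] =
    (\prod_(j < s) (k j)`!)%:R * (m == k)%:R.
  rewrite fdiffm_fallmon mevalZ meval0_fallmon.
  have [->|mk] := eqVneq m k.
    rewrite (_ : (k - k)%MM = 0%MM); last by apply/mnmP => i; rewrite !mnmE subnn.
    by rewrite eqxx !mulr1; congr _%:R; apply: eq_bigr => j _; rewrite ffactnn.
  (* Truncated subtraction may give [m - k = 0] although m and k differ; then some [m j < k j], and
     the falling factorial coefficient vanishes instead. *)
  rewrite mulr0; have [/eqP mk0|] := boolP (m - k == 0)%MM; last by rewrite mulr0.
  have [j mkj] : exists j, (m j < k j)%N.
    apply/existsP; apply: contraNT mk => /existsPn km; apply/eqP/mnmP => j.
    apply/eqP; rewrite eqn_leq -subn_eq0 -mnmBE mk0 mnmE eqxx /=.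
    by rewrite leqNgt km.
  by rewrite (bigD1 j) //= ffact_small // mul0n mul0r.
rewrite [newton r]/newton raddf_mlin /= /mlin raddf_sum /=.
rewrite (eq_bigr (fun m => (\prod_(j < s) (k j)`!)%:R * (r@_m * 'X_[m]@_k))).
  rewrite -mulr_sumr; congr (_ * _).
  rewrite [in RHS](mpolyE r) raddf_sum /=.
  by apply: eq_bigr => m _; rewrite mcoeffZ.
by move=> m _; rewrite mevalZ diag mcoeffX mulrCA.
Qed.

(** Induction on the degree builds monomials from falling factorials. The size bound is kept because
    [Lop] sums only over exponents up to the degree of its argument. *)
Lemma newton_surj p : exists2 r, (msize r <= msize p)%N & p = newton r.
Proof.
pose P n p := exists2 r, (msize r <= n)%N & p = newton r.
have P0 n : P n 0 by exists 0; rewrite ?msize0 // [RHS]linear0.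
have PD n p1 p2 : P n p1 -> P n p2 -> P n (p1 + p2).
  move=> [r1 r1n ->] [r2 r2n ->]; exists (r1 + r2); last by rewrite [RHS]linearD.
  by apply: leq_trans (msizeD_le _ _) _; rewrite geq_max r1n.
have PZ n c p1 : P n p1 -> P n (c *: p1).
  move=> [r1 r1n ->]; exists (c *: r1); last by rewrite [RHS]linearZ.
  exact: leq_trans (msizeZ_le _ _) r1n.
have Pfall n m : (mdeg m < n)%N -> P n (fallmon m).
  by move=> mn; exists 'X_[m]; rewrite ?msizeX // [RHS]mlinX.
have PX n j p1 : P n p1 -> P n.+1 ('X_j * p1).
  move=> [r rn ->]; rewrite /newton /mlin mulr_sumr big_seq.
  apply: (big_ind (P n.+1)) => // [|m mr]; first exact: PD.
  have mn : (mdeg m < n)%N by apply: leq_trans rn; apply: msize_mdeg_lt.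
  rewrite -scalerAr; apply: (PZ).
  (* The factor X_j is split as (X_j - m_j) + m_j; the first summand prolongs the falling factorial
     by one factor. *)
  have -> : 'X_j * fallmon m =
      fallmon (U_(j) + m)%MM + (m j)%:R *: fallmon m :> {mpoly F[s]}.
    rewrite /fallmon (bigD1 j) //= [in RHS](bigD1 j) //= mnmDE mnm1E eqxx add1n.
    rewrite fallingSr.
    rewrite [in X in _ = _ * X + _](eq_bigr (fun i => falling 'X_i (m i))).
      rewrite scaler_nat -mulr_natl; ring.
    by move=> i ij; rewrite mnmDE mnm1E eq_sym (negbTE ij).
  apply: PD; first by apply: Pfall; rewrite mdegD mdeg1.
  by apply/PZ/Pfall; exact: ltnW.
have Pmon m : P (mdeg m).+1 'X_[m].
  move: {2}(mdeg m) (erefl (mdeg m)) => n; elim: n m => [|n IHn] m mn.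
    move/eqP: mn; rewrite mdeg_eq0 => /eqP ->.
    have -> : 'X_[0] = fallmon 0 :> {mpoly F[s]}.
      by rewrite mpolyX0 /fallmon big1 // => j _; rewrite mnmE /falling big_ord0.
    exact: Pfall.
  have [j mj] : exists j, m j != 0%N.
    apply/existsP; apply: contra_eqT mn => /existsPn m0.
    rewrite (_ : m = 0%MM) ?mdeg0 //; apply/mnmP => j; rewrite mnmE.
    by apply/eqP; rewrite -[_ == _]negbK m0.
  have mE : m = (U_(j) + (m - U_(j)))%MM.
    rewrite addmC submK //; apply/mnm_lepP => i; rewrite mnm1E.
    by case: eqP => // <-; rewrite lt0n.
  move: mn; rewrite mE mdegD mdeg1 add1n mpolyXD => -[mn]; apply: (PX).
  exact: IHn.
suff: P (msize p) p by [].
rewrite {2}(mpolyE p) big_seq; apply: (big_ind (P (msize p))) => // [|m mp].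
  exact: PD.
have [r rm rE] := Pmon m; apply: (PZ); exists r => //.
exact: leq_trans rm (msize_mdeg_lt mp).
Qed.

Lemma iter_fdiff_nilpotent p : exists n, forall j, iter n (fdiff j) p = 0.
Proof.
have [r _ ->] := newton_surj p; exists (msize r) => j.
have iter_linear : linear (iter (msize r) (@fdiff F s j)).
  move=> c q1 q2; elim: (msize r) => // n IHn.
  by rewrite !iterS IHn linearP.
(* The iterate is packed as a linear map so that it passes through the expansion of [newton r].
   Every exponent occurring in [r] is below [msize r], so each term is killed. *)
pose f := GRing.isLinear.Build F _ _ *:%R _ iter_linear.
pose g : {linear {mpoly F[s]} -> {mpoly F[s]}} :=
  HB.pack (iter (msize r) (@fdiff F s j)) f.
rewrite -[iter _ _ _]/(g _) raddf_mlin /mlin big_seq big1 // => m mr /=.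
rewrite iter_fdiff_fallmon ffact_small ?scale0r ?scaler0 //.
apply: leq_ltn_trans (msize_mdeg_lt mr).
by rewrite mdegE (bigD1 j) //= leq_addr.
Qed.

Hypothesis charF : [pchar F] =i pred0.

(** Characteristic 0 makes the factorials invertible, so duality recovers each coefficient. *)
Lemma newtonK : cancel newton (@Lop F s).
Proof.
have factK k : (\prod_(j < s) (k j)`!)%:R != 0 :> F.
  move/pcharf0P: charF => ->; rewrite -lt0n prodn_gt0 // => j.
  exact: fact_gt0.
have coefE k r :
    (\prod_(j < s) (k j)`!)%:R^-1 * (fdiffm k (newton r)).@[fun=> 0] = r@_k.
  by rewrite meval0_fdiffm_newton mulKf.
(* The preimage [r'] carries a size bound. Comparing coefficients gives [r' = r], so the sum in
   [Lop], cut off at the degree of [newton r], reaches every coefficient of [r]. *)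
move=> r; have [r' r'p eq_rr'] := newton_surj (newton r).
have rr' : r' = r by apply/mpolyP => k; rewrite -!coefE eq_rr'.
rewrite rr' in r'p; rewrite [RHS](mpolywE r'p) /Lop.
by apply: eq_bigr => m _; rewrite coefE.
Qed.

Lemma Lop_inj : injective (@Lop F s).
Proof.
move=> p q; have [r _ ->] := newton_surj p; have [r' _ ->] := newton_surj q.
by rewrite !newtonK => ->.
Qed.

End Newton.

(** * Differential functionals on Laurent polynomials as pairings with sequences *)

Section LaurentDuality.
Context {F : fieldType} {s : nat}.
Local Notation K := 'cV[int]_s.
Local Notation lmon k c := (monalg.mkmalgU (k : K) (c : F) : laurent F s).
Implicit Types (f g h : laurent F s) (p q r : {mpoly F[s]}) (theta : 'cV[F]_s).
Implicit Types (m : 'X_{1..s}) (j : 'I_s) (k : K) (c : K -> F).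

Definition llin {V : lmodType F} (G : K -> V) f : V :=
  \sum_(k <- monalg.msupp f) monalg.mcoeff k f *: G k.

Lemma llinw {V : lmodType F} (G : K -> V) f (d : {fset K}) :
  (monalg.msupp f `<=` d)%fset ->
  llin G f = \sum_(k <- d) monalg.mcoeff k f *: G k.
Proof.
move=> sub_fd; apply: big_fset_incl => // k _ /monalg.mcoeff_outdom ->.
by rewrite scale0r.
Qed.

Lemma llin_is_linear {V : lmodType F} (G : K -> V) : linear (llin G).
Proof.
move=> a f g.
pose d :=
  (monalg.msupp (a *: f + g) `|` (monalg.msupp f `|` monalg.msupp g))%fset.
rewrite !(@llinw _ _ _ d) ?fsubsetUl //; last 2 first.
- by rewrite fsubsetU // fsubsetUr orbT.
- by rewrite fsubsetU // fsubsetUl orbT.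
rewrite scaler_sumr -big_split /=; apply: eq_bigr => k _.
by rewrite monalg.mcoeffD monalg.mcoeffZ scalerDl scalerA.
Qed.

HB.instance Definition _ {V : lmodType F} (G : K -> V) :=
  GRing.isLinear.Build F (laurent F s) V *:%R (llin G) (llin_is_linear G).

Lemma llinU {V : lmodType F} (G : K -> V) k a : llin G (lmon k a) = a *: G k.
Proof.
by rewrite (llinw _ monalg.msuppU_le) big_seq_fset1 monalg.mcoeffUU.
Qed.

Lemma raddf_llin {V W : lmodType F} (u : {linear V -> W}) G f :
  u (llin G f) = llin (fun k => u (G k)) f.
Proof. by rewrite /llin linear_sum; apply: eq_bigr => m _; rewrite linearZ. Qed.

Lemma scale_lmon a k b : a *: lmon k b = lmon k (a * b).
Proof.
apply/monalg.malgP => l.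
by rewrite [RHS]monalg.mcoeffU monalg.mcoeffZ monalg.mcoeffU mulrnAr.
Qed.

Lemma llin_id f : llin (fun k => lmon k 1) f = f.
Proof.
rewrite [RHS]monalg.monalgE; apply: eq_bigr => k _.
by rewrite scale_lmon mulr1.
Qed.

Lemma lderivE j :
  @lderiv F s j =1 llin (fun k => lmon (k - delta_mx j 0) (k j 0)%:~R).
Proof. by move=> f; apply: eq_bigr => k _; rewrite scale_lmon. Qed.

Lemma lderivm_is_linear m : linear (@lderivm F s m).
Proof.
move=> a f g; rewrite /lderivm; elim: (enum _) => // j l /= ->.
elim: (m j) => // n IHn.
by rewrite !iterS IHn !lderivE linearP.
Qed.

HB.instance Definition _ m :=
  GRing.isLinear.Build F (laurent F s) (laurent F s) *:%R (@lderivm F s m)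
    (lderivm_is_linear m).

Lemma iter_lderiv_lmon n j k a :
  iter n (lderiv j) (lmon k a) =
  lmon (k - (delta_mx j 0) *+ n) (a * falling (k j 0)%:~R n).
Proof.
elim: n => [|n IHn]; first by rewrite subr0 /falling big_ord0 mulr1.
rewrite iterS IHn lderivE llinU scale_lmon fallingSr mulrSr opprD addrA.
congr (monalg.mkmalgU _ _); rewrite mulrA; congr (_ * _).
rewrite !mxE mulmxnE !mxE !eqxx rmorphB /=.
by rewrite rmorph_nat.
Qed.

Lemma lderivm_lmon m k a :
  lderivm m (lmon k a) =
  lmon (k - \col_j (m j)%:Z) (a * \prod_j falling (k j 0)%:~R (m j)).
Proof.
have lderiv_on l : uniq l ->
    foldr (fun j g => iter (m j) (lderiv j) g) (lmon k a) l =
    lmon (k - \col_j ((j \in l) * m j)%N%:Z)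
      (a * \prod_(j <- l) falling (k j 0)%:~R (m j)).
  elim: l => [_|j l IHl /= /andP[jl /IHl ->]].
    rewrite big_nil mulr1 /= (_ : \col_j _ = 0) ?subr0 //.
    by apply/matrixP => i i'; rewrite !mxE.
  rewrite iter_lderiv_lmon big_cons -mulrA.
  congr (monalg.mkmalgU _ _); last first.
    by rewrite !mxE (negbTE jl) mul0n subr0 [_ * falling _ _]mulrC.
  rewrite -addrA -opprD; congr (_ - _); apply/matrixP => i i'; rewrite ord1.
  rewrite mxE mulmxnE !mxE inE eqxx andbT eq_sym.
  case: eqP => [<-|_]; last by rewrite mul0rn addr0.
  by rewrite (negbTE jl) mul0n add0r mul1n natz.
rewrite /lderivm lderiv_on; last exact: enum_uniq.
rewrite big_enum; congr (monalg.mkmalgU _ _).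
by congr (_ - _); apply/matrixP => i i'; rewrite !mxE mem_enum mul1n.
Qed.

(** With the argument [- k], multiplying [f] by a monomial translates [c], and subdivision becomes a
    pairing with a subsymbol. [F^o] is [F] as a module over itself. *)
Definition pair c f : F := llin (fun k => c (- k) : F^o) f.

(* [eseq theta q] is the element of P_theta e_theta attached to [q]: [newton]
   is L^-1 in characteristic 0. *)
Definition eseq theta q : K -> F := fun alpha =>
  (sigma_minus (newton (sigma theta q))).@[fun j => (alpha j 0)%:~R]
  * zpow theta alpha.

Lemma zpowD theta k l : (forall j, theta j 0 != 0) ->
  zpow theta (k + l) = zpow theta k * zpow theta l.
Proof.
move=> nz; rewrite /zpow -big_split /=; apply: eq_bigr => j _.
by rewrite mxE expfzDr.
Qed.

Lemma newton_sigma theta q :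
  newton (sigma theta q) =
  mlin (fun m => (\prod_j theta j 0 ^+ m j) *: fallmon m) q.
Proof.
rewrite /sigma comp_mpolyEX -/(mlin _ _) /newton raddf_mlin.
apply: eq_mlin => m; rewrite -[fallmon m]mlinX -linearZ; congr (mlin _ _).
rewrite comp_mpolyX.
rewrite (eq_bigr (fun j => (theta j 0 ^+ m j) *: 'X_j ^+ m j)); last first.
  by move=> j _; rewrite tnth_mktuple exprZn.
by rewrite scaler_prod -mpolyXE_id.
Qed.

(** The reflection [sigma_minus] cancels the sign of the argument, leaving the falling factorials at
    [k] that also arise from differentiating z^k. *)
Lemma eseqN theta q k :
  eseq theta q (- k) =
  mlin (fun m => ((\prod_j theta j 0 ^+ m j)
    * (\prod_j falling (k j 0)%:~R (m j))) : F^o) q * zpow theta (- k).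
Proof.
rewrite /eseq /sigma_minus comp_mpoly_meval newton_sigma; congr (_ * _).
rewrite /mlin raddf_sum; apply: eq_bigr => m _ /=.
rewrite !mevalZ; congr (_ * (_ * _)); rewrite meval_fallmon.
apply: eq_bigr => j _; rewrite tnth_mktuple mevalN mevalXU mxE.
by rewrite rmorphN opprK.
Qed.

(** Evaluating z^(k-m) at theta^-1 leaves theta^m theta^(-k); the factor theta^m is the one that
    [sigma theta] contributes to [eseq]. *)
Lemma leval_lderivm_lmon theta m k : (forall j, theta j 0 != 0) ->
  leval (lderivm m (lmon k 1)) (vinv theta) =
  (\prod_j theta j 0 ^+ m j) * (\prod_j falling (k j 0)%:~R (m j))
    * zpow theta (- k).
Proof.
move=> nz; rewrite lderivm_lmon -[leval _ _]/(llin (zpow _ : K -> F^o) _) llinU.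
rewrite mul1r [_ * \prod_j falling _ _]mulrC -mulrA; congr (_ * _).
rewrite /zpow -big_split; apply: eq_bigr => j _ /=; rewrite !mxE.
by rewrite exprz_inv opprD opprK expfzDr // mulrC.
Qed.

Lemma leval_sum (I : Type) (e : seq I) (a : I -> F) (g : I -> laurent F s) theta :
  leval (\sum_(i <- e) a i *: g i) theta =
  \sum_(i <- e) a i * leval (g i) theta.
Proof.
rewrite -[leval _ _]/(llin (zpow _ : K -> F^o) _) linear_sum.
by apply: eq_bigr => i _; rewrite linearZ.
Qed.

(** Both sides are double sums over the supports of [q] and [f]; after exchanging them, the terms
    agree for each pair of monomials. *)
Lemma leval_lopD theta q f : (forall j, theta j 0 != 0) ->
  leval (lopD q f) (vinv theta) = pair (eseq theta q) f.
Proof.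
move=> nz; rewrite leval_sum.
under eq_bigr => m _ do
  rewrite -[in lderivm m f](llin_id f) raddf_llin leval_sum mulr_sumr.
rewrite exchange_big; apply: eq_bigr => k _ /=.
rewrite eseqN mulr_suml [RHS]mulr_sumr; apply: eq_bigr => m _.
by rewrite mulrCA leval_lderivm_lmon // -[in RHS]mulrA.
Qed.

(** Bijectivity of L turns the preimage under [Lop] into an image under [newton]. *)
Lemma exp_poly_Pspace theta (Q : set {mpoly F[s]}) : [pchar F] =i pred0 ->
  exp_poly theta (Pspace theta Q) = eseq theta @` Q.
Proof.
move=> charF; apply/seteqP; split=> [_ [_ [p [q Qq Lp] <-] <-]|_ [q Qq <-]].
  exists q => //; rewrite /eseq (_ : newton _ = p) //.
  by apply: (Lop_inj charF); rewrite newtonK.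
exists (sigma_minus (newton (sigma theta q))) => //.
by exists (newton (sigma theta q)) => //; exists q; rewrite ?newtonK.
Qed.

End LaurentDuality.

(** * Annihilators under the pairing *)

Section Kernel.
Context {F : fieldType} {s : nat}.
Local Notation K := 'cV[int]_s.
Local Notation lmon k c := (monalg.mkmalgU (k : K) (c : F) : laurent F s).
Implicit Types (f g h : laurent F s) (p q : {mpoly F[s]}) (theta : 'cV[F]_s).
Implicit Types (j : 'I_s) (k : K) (c u v : K -> F).

Lemma pair_linr c b f g : pair c (b *: f + g) = b * pair c f + pair c g.
Proof. exact: (llin_is_linear (fun k => c (- k) : F^o)). Qed.

Lemma pair_is_additive c : additive (pair c).
Proof. by move=> f g; rewrite addrC -scaleN1r pair_linr mulN1r addrC. Qed.

HB.instance Definition _ c :=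
  GRing.isAdditive.Build (laurent F s) F (pair c) (pair_is_additive c).

Lemma pairU c k a : pair c (lmon k a) = a * c (- k).
Proof. exact: (llinU (fun k => c (- k) : F^o)). Qed.

Lemma pair_linl a u v f :
  pair (fun k => a * u k + v k) f = a * pair u f + pair v f.
Proof.
rewrite /pair /llin mulr_sumr -big_split; apply: eq_bigr => k _ /=.
by rewrite scalerDr; congr (_ + _); rewrite [LHS]mulrCA.
Qed.

Lemma pair_mul c h f :
  pair c (h * f) = pair (fun k => pair (fun l => c (k + l)) f) h.
Proof.
rewrite -[h * f]/(lmul h f) /lmul raddf_sum; apply: eq_bigr => k _ /=.
rewrite raddf_sum /pair scaler_sumr; apply: eq_bigr => l _ /=.
by rewrite [LHS]pairU opprD -mulrA.
Qed.

Lemma double_annihilator (S : seq (K -> F)) (W : set (K -> F)) c :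
  W (fun=> 0) -> (forall a u v, W u -> W v -> W (fun k => a * u k + v k)) ->
  (forall u, u \in S -> W u) ->
  (forall f, (forall u, u \in S -> pair u f = 0) -> pair c f = 0) -> W c.
Proof.
move=> W0 WL; elim: S c => [|u0 S IHS] c WS annc.
  rewrite (_ : c = fun=> 0) //; apply/funext => k.
  (* With no constraint left, pairing with z^(-k) reads off [c k]. *)
  have: pair c (lmon (- k) 1) = 0 by apply: annc.
  by rewrite pairU mul1r opprK.
have WS' u : u \in S -> W u by move=> uS; apply: WS; rewrite inE uS orbT.
have [[g]|annu0] := pselect (exists g,
    (forall u, u \in S -> pair u g = 0) /\ pair u0 g != 0); last first.
  apply: IHS => // f annf; apply: annc => u; rewrite inE => /orP[/eqP ->|/annf//].
  by apply: contra_notP annu0 => /eqP u0f; exists f.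
case=> annSg u0g; pose a : F := pair c g / pair u0 g.
have : W (fun k => - a * u0 k + c k).
  apply: IHS => // f annf; rewrite pair_linl.
  (* Subtracting [b] times [g] from [f] makes it vanish under [u0] while keeping it in the kernel of
     [S], so the hypothesis on [c] applies. *)
  pose b : F := pair u0 f / pair u0 g.
  have : pair c (- b *: g + f) = 0.
    apply: annc => u; rewrite inE => /orP[/eqP ->|uS].
      by rewrite pair_linr mulNr divfK // addNr.
    by rewrite pair_linr annf // annSg // mulr0 addr0.
  by rewrite pair_linr => <-; rewrite /a /b; ring.
move=> Wc; have -> : c = (fun k => a * u0 k + (- a * u0 k + c k)).
  by apply/funext => k; ring.
by apply: WL => //; apply: WS; rewrite inE eqxx.
Qed.

Lemma eseqP theta a p q :
  eseq theta (a *: p + q) = (fun k => a * eseq theta p k + eseq theta q k).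
Proof.
apply/funext => k; rewrite /eseq /sigma /newton /sigma_minus !linearP /=.
by rewrite mulrDl mulrA.
Qed.

Lemma linear_form_sum (V : lmodType F) (G : V -> F) n a (b : 'I_n -> V) :
  linear_for *%R G ->
  G (\sum_(i < n) a i *: b i) = \sum_(i < n) a i * G (b i).
Proof.
move=> lin; elim: n a b => [|n IHn] a b.
  (* Linearity at the scalar -1 gives G 0 = - G 0 + G 0 = 0. *)
  have := lin (-1) 0 0; rewrite !big_ord0 scaler0 addr0 => ->.
  by rewrite mulN1r addNr.
by rewrite !big_ord_recl lin IHn.
Qed.

Lemma eseq_sum theta n (a : 'I_n -> F) (b : 'I_n -> {mpoly F[s]}) f :
  pair (eseq theta (\sum_(i < n) a i *: b i)) f =
  \sum_(i < n) a i * pair (eseq theta (b i)) f.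
Proof.
apply: (@linear_form_sum _ (fun q => pair (eseq theta q) f)) => c p q.
by rewrite eseqP pair_linl.
Qed.

(** * The kernel of subdivision as the annihilator of the subsymbol ideal *)

Section Subdivision.
Variables (Xi : 'M[int]_s) (a : K -> F).
Hypothesis Xi_inj : injective (mulmx Xi : K -> K).
Hypothesis fin_a : finitely_supported a.

(** On a fixed coset of [Xi], subdivision is a convolution with the subsymbol; the substitution
    alpha = gamma - k exhibits it. *)
Lemma subdivision_pair c xi gamma :
  subdivision Xi a c (xi + Xi *m gamma) =
  pair (fun k => c (gamma + k)) (subsymbol Xi a xi).
Proof.
(* Injectivity of [Xi] transfers finite support from [a] to the coefficients of the subsymbol, so
   both sums run over one finite set. *)
have fin_axi : finite_set [set alpha | a (xi + Xi *m alpha) != 0].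
  apply: (@finite_preimage _ _ [set x | a x != 0]
    (fun alpha => xi + Xi *m alpha)).
    by move=> x y _ _ /addrI /Xi_inj.
  exact: fin_a.
pose A := fset_set [set alpha | a (xi + Xi *m alpha) != 0].
have out k : k \notin A -> a (xi + Xi *m k) = 0.
  move=> kA; apply: contraNeq kA => ak.
  by rewrite in_fset_set // inE.
rewrite /subsymbol (fsbigTE A); last first.
  by move=> k /out ->; rewrite monalg.monalgU0.
rewrite raddf_sum /subdivision.
rewrite (reindex_fsbigT (fun k => gamma - k)); last first.
  by exists (fun k => gamma - k) => k; rewrite opprB addrC subrK.
have subE k : xi + Xi *m gamma - Xi *m (gamma - k) = xi + Xi *m k.
  by rewrite mulmxBr opprB addrA addrAC addrK.
rewrite (fsbigTE A) => [|k /out ak]; last by rewrite subE ak mul0r.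
by apply: eq_bigr => k _; rewrite subE [RHS]pairU.
Qed.

Lemma ker_subdivision_pair (E : set K) c :
  (forall beta, exists2 xi, E xi & exists gamma, beta = xi + Xi *m gamma) ->
  ker_subdivision Xi a c <->
  forall f, ideal_gen [set subsymbol Xi a xi | xi in E] f -> pair c f = 0.
Proof.
move=> coverE; split=> [ker_c f Jf|annc].
  (* Vanishing against all translates of [c] defines an ideal, since multiplication by a monomial
     only permutes the translates. It contains the generators, hence the whole ideal. *)
  have: [set g | forall gamma, pair (fun k => c (gamma + k)) g = 0] f.
    apply: Jf; split=> [|_ [xi _ <-] gamma]; last first.
      by rewrite -subdivision_pair ker_c.
    split=> [gamma|g h cg ch gamma|h g cg gamma].
    - by rewrite raddf0.
    - by rewrite raddfD /= cg ch addr0.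
    - rewrite pair_mul (_ : (fun k => _) = fun=> 0) /pair.
        by rewrite /llin big1 // => k _; rewrite scaler0.
      by apply/funext => k; under eq_fun do rewrite addrA; apply: cg.
  move=> /(_ 0); congr (pair _ _ = _).
  by apply/funext => k; rewrite add0r.
apply/funext => beta; have [xi Exi [gamma ->]] := coverE beta.
rewrite subdivision_pair [RHS]/(0 : F).
(* Multiplying by z^(-gamma) stays in the ideal and recovers the translate of [c] by gamma. *)
have: pair c (lmon (- gamma) 1 * subsymbol Xi a xi) = 0.
  apply: annc => I [[_ _ II] GI]; apply/II/GI.
  by exists xi.
by rewrite pair_mul pairU mul1r opprK.
Qed.

End Subdivision.

(** * Shift operators and independence of exponential polynomials *)

Definition shiftop j (b : F) c : K -> F :=
  fun k => c (k + delta_mx j 0) - b * c k.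

Lemma shiftopC i j a b c :
  shiftop i a (shiftop j b c) = shiftop j b (shiftop i a c).
Proof.
by apply/funext => k; rewrite /shiftop [k + _ + _]addrAC; ring.
Qed.

Lemma iter_shiftopC m n i j a b c :
  iter m (shiftop i a) (iter n (shiftop j b) c) =
  iter n (shiftop j b) (iter m (shiftop i a) c).
Proof.
have comm1 c' : shiftop i a (iter n (shiftop j b) c') =
    iter n (shiftop j b) (shiftop i a c').
  by elim: n => //= n IHn; rewrite shiftopC IHn.
by elim: m => //= m ->.
Qed.

Lemma iter_shiftop_is_additive n j b :
  additive (iter n (shiftop j b) : (K -> F) -> (K -> F)).
Proof.
move=> c c'; elim: n => // n IHn; rewrite !iterS IHn.
by apply/funext => k; rewrite /shiftop !fctE; ring.
Qed.

HB.instance Definition _ n j b :=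
  GRing.isAdditive.Build (K -> F) (K -> F) (iter n (shiftop j b))
    (iter_shiftop_is_additive n j b).

(* On the kernel of the shift minus [b], the shift minus [a] is
   multiplication by [b - a]. *)
Lemma shiftop_coprime m n j a b c : a != b ->
  iter m (shiftop j a) c = 0 -> iter n (shiftop j b) c = 0 -> c = 0.
Proof.
move=> ab ma; elim: n => // n IHn; rewrite iterS; set w := iter n _ c => w0.
apply: IHn; rewrite -/w.
have mw : iter m (shiftop j a) w = 0.
  by rewrite iter_shiftopC ma raddf0.
have wE k : w (k + delta_mx j 0) = b * w k.
  by have /eqP := congr1 (@^~ k) w0; rewrite subr_eq0 => /eqP.
have mwE k : iter m (shiftop j a) w k = (b - a) ^+ m * w k.
  elim: m k {ma mw} => [|m IHm] k; first by rewrite mul1r.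
  by rewrite iterS /shiftop !IHm wE exprS; ring.
apply/funext => k; have := congr1 (@^~ k) mw; rewrite mwE => /eqP.
by rewrite mulf_eq0 expf_eq0 subr_eq0 eq_sym (negbTE ab) andbF => /eqP.
Qed.

(** A power of the shift minus a coordinate of [theta0] removes [u theta0] from the sum. By
    induction it kills every other term too, and coprimality in a coordinate where the two points
    differ makes that term zero. *)
Lemma shiftop_independent (A : seq 'cV[F]_s) (u : 'cV[F]_s -> K -> F) :
  uniq A ->
  (forall theta, theta \in A ->
     exists n, forall j, iter n (shiftop j (theta j 0)) (u theta) = 0) ->
  \sum_(theta <- A) u theta = 0 -> forall theta, theta \in A -> u theta = 0.
Proof.
elim: A u => // theta0 A IHA u /= /andP[th0A uniqA] nilp sum0.
have uA theta : theta \in A -> u theta = 0.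
  move=> thA; have [j neq_j] : exists j, theta0 j 0 != theta j 0.
    apply/existsP; apply: contraNT th0A => /existsPn eq_th.
    rewrite (_ : theta0 = theta) //; apply/matrixP => i i'.
    by rewrite ord1; apply/eqP; rewrite -[_ == _]negbK eq_th.
  have [n0 n0P] := nilp theta0 (mem_head _ _).
  have [n nP] : exists n, forall j, iter n (shiftop j (theta j 0)) (u theta) = 0.
    by apply: nilp; rewrite inE thA orbT.
  apply: shiftop_coprime neq_j _ (nP j).
  (* The transformed terms satisfy the same nilpotency because the shift operators commute. *)
  apply: (IHA (fun th => iter n0 (shiftop j (theta0 j 0)) (u th))) => //.
    move=> th thA'; have [|n1 n1P] := nilp th; first by rewrite inE thA' orbT.
    by exists n1 => i; rewrite iter_shiftopC n1P raddf0.
  rewrite -raddf_sum; have := congr1 (iter n0 (shiftop j (theta0 j 0))) sum0.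
  by rewrite big_cons raddfD /= n0P add0r raddf0.
move=> theta; rewrite inE => /orP[/eqP ->|]; last exact: uA.
by move: sum0; rewrite big_cons big_seq big1 ?addr0.
Qed.

(** Since [zpow theta] is multiplied by theta_j under the shift, only the difference of the
    polynomial factor survives. Differences are nilpotent on polynomials, which yields the next
    lemma. *)
Lemma iter_shiftop_exp n j theta p : (forall j, theta j 0 != 0) ->
  iter n (shiftop j (theta j 0))
    (fun k => p.@[fun i => (k i 0)%:~R] * zpow theta k) =
  (fun k => theta j 0 ^+ n * ((iter n (fdiff j) p).@[fun i => (k i 0)%:~R]
    * zpow theta k)).
Proof.
move=> nz; elim: n => [|n IHn]; first by apply/funext => k; rewrite mul1r.
rewrite iterS IHn; apply/funext => k; rewrite /shiftop iterS zpowD //.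
set q := iter n _ p; rewrite /fdiff mevalB comp_mpoly_meval.
have -> : zpow theta (delta_mx j 0) = theta j 0.
  rewrite /zpow (bigD1 j) //= mxE !eqxx big1 ?mulr1 // => i ij.
  by rewrite mxE (negbTE ij) expr0z.
rewrite [X in _ = _ * ((X - _) * _)](meval_eq
  (v2 := fun i => ((k + delta_mx j 0) i 0)%:~R)); last first.
  move=> i; rewrite tnth_mktuple mevalD mevalXU !mxE eqxx andbT rmorphD /=.
  by congr (_ + _); case: eqP => _; rewrite ?meval1 ?meval0.
by rewrite exprS; ring.
Qed.

Lemma eseq_nilpotent theta q : (forall j, theta j 0 != 0) ->
  exists n, forall j, iter n (shiftop j (theta j 0)) (eseq theta q) = 0.
Proof.
move=> nz; rewrite /eseq; set p := sigma_minus _.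
have [n nP] := iter_fdiff_nilpotent p; exists n => j.
rewrite iter_shiftop_exp // nP; apply/funext => k.
by rewrite meval0 mul0r mulr0.
Qed.

End Kernel.

(** * Assembly of the direct sum *)

Section DirectSum.
Context {F : fieldType} {s : nat}.
Local Notation K := 'cV[int]_s.
Implicit Types (f : laurent F s) (p q : {mpoly F[s]}) (theta : 'cV[F]_s).

Lemma finite_dim_subspace_linear (V : lmodType F) (Q : set V) :
  finite_dim_subspace Q ->
  Q 0 /\ forall (a : F) (u v : V), Q u -> Q v -> Q (a *: u + v).
Proof.
move=> [n [b ->]]; split.
  by exists (fun=> 0) => //; rewrite big1 // => i _; rewrite scale0r.
move=> a _ _ [c _ <-] [d _ <-]; exists (fun i => a * c i + d i) => //.
rewrite scaler_sumr -big_split; apply: eq_bigr => i _ /=.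
by rewrite scalerDl scalerA.
Qed.

(** Supplies the finite list required by [double_annihilator]: the sequences of the spanning vectors
    of all [Q theta], whose common kernel is that of the whole sum. *)
Lemma eseq_generators (A : seq 'cV[F]_s) (Q : 'cV[F]_s -> set {mpoly F[s]}) :
  (forall theta, theta \in A -> finite_dim_subspace (Q theta)) ->
  exists2 S : seq (K -> F),
    forall u, u \in S ->
      exists theta q, [/\ theta \in A, Q theta q & u = eseq theta q] &
    forall f, (forall u, u \in S -> pair u f = 0) ->
      forall theta q, theta \in A -> Q theta q -> pair (eseq theta q) f = 0.
Proof.
elim: A => [|theta0 A IHA] fdQ; first by exists [::].
have [|S SA annS] := IHA.
  by move=> theta thA; apply: fdQ; rewrite inE thA orbT.
have [n [b Qb]] := fdQ theta0 (mem_head _ _).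
exists ([seq eseq theta0 (b i) | i <- enum 'I_n] ++ S).
  move=> u; rewrite mem_cat => /orP[/mapP[i _ ->]|/SA[theta [q [thA Qq ->]]]].
    exists theta0, (b i); split; rewrite ?mem_head // Qb.
    exists (fun j => (i == j)%:R) => //.
    rewrite (bigD1 i) //= eqxx scale1r big1 ?addr0 // => j.
    by rewrite eq_sym => /negbTE ->; rewrite scale0r.
  by exists theta, q; rewrite inE thA orbT.
move=> f annf theta q; rewrite inE => /orP[/eqP ->|thA].
  rewrite Qb => -[c _ <-]; rewrite eseq_sum big1 // => i _.
  rewrite annf ?mulr0 // mem_cat; apply/orP; left.
  by apply/mapP; exists i; rewrite ?mem_enum.
by apply: annS thA => u uS; apply: annf; rewrite mem_cat uS orbT.
Qed.

Lemma ker_subdivision_direct_sum (Xi : 'M[int]_s) (a : K -> F) (E : set K)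
    (Theta : {fset 'cV[F]_s}) (Q : 'cV[F]_s -> set {mpoly F[s]}) :
  [pchar F] =i pred0 ->
  injective (mulmx Xi : K -> K) ->
  (forall beta, exists2 xi, E xi & exists gamma, beta = xi + Xi *m gamma) ->
  finitely_supported a ->
  zero_dim_with (ideal_gen [set subsymbol Xi a xi | xi in E]) Theta Q ->
  is_direct_sum Theta
    (fun theta => exp_poly theta (Pspace theta (Q theta)))
    (ker_subdivision Xi a).
Proof.
move=> charF Xi_inj coverE fin_a [nz subQ JE].
have fdQ theta : theta \in Theta -> finite_dim_subspace (Q theta).
  by move=> /subQ[].
(* The ideal is the common kernel of the pairings with all [eseq theta q], so the kernel of
   subdivision is the double annihilator of these sequences. *)
have kerE c : ker_subdivision Xi a c <-> forall f,
    (forall theta q, theta \in Theta -> Q theta q -> pair (eseq theta q) f = 0) ->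
    pair c f = 0.
  apply: iff_trans (ker_subdivision_pair Xi_inj fin_a c coverE) _.
  by split=> annc f annf; apply: annc; [apply/JE|move: annf => /JE annf];
    move=> theta q thT Qq; [rewrite leval_lopD|rewrite -leval_lopD];
    auto; exact: nz.
have pairD u v f : pair (u + v) f = pair u f + pair v f.
  rewrite -[pair u f]mul1r -pair_linl; congr pair; apply/funext => k.
  by rewrite mul1r.
have pair0 f : pair (0 : K -> F) f = 0.
  by have /eqP := pairD 0 0 f; rewrite addr0 -subr_eq subrr eq_sym => /eqP.
have eseq0 theta : eseq theta 0 = 0.
  apply/funext => k; have := eseqP theta (-1) 0 0; rewrite scaler0 addr0 => ->.
  by rewrite mulN1r addNr.
rewrite (_ : (fun theta => _) = (fun theta => eseq theta @` Q theta)); last first.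
  by apply/funext => theta; rewrite exp_poly_Pspace.
split; last first.
  move=> u uQ; apply: shiftop_independent; first exact: fset_uniq.
  by move=> theta thT; have [q _ <-] := uQ _ thT; apply/eseq_nilpotent/nz.
apply/seteqP; split=> [c ker_c|_ [u uQ <-]]; last first.
  apply/kerE => f annf; rewrite big_seq.
  apply: (big_ind (fun c => pair c f = 0)) => // [u1 u2 u1f u2f|theta thT].
    by rewrite pairD u1f u2f addr0.
  by have [q Qq <-] := uQ _ thT; apply: annf.
(* For the remaining inclusion, [double_annihilator] is applied with [W] the set of sums; the first
   three goals check that [W] is a linear space containing the generators. *)
have [S ST annS] := eseq_generators fdQ.
apply: (@double_annihilator _ _ S) =>
  [|b u v|u /ST[theta [q [thT Qq ->]]]|f annf].
- exists (fun=> 0) => [theta /fdQ/finite_dim_subspace_linear[Q0 _]|].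
    by exists 0.
  by rewrite big1.
- move=> [u1 u1Q <-] [v1 v1Q <-].
  exists (fun theta k => b * u1 theta k + v1 theta k).
    move=> theta thT; have [p Qp <-] := u1Q _ thT; have [q Qq <-] := v1Q _ thT.
    exists (b *: p + q); last exact: eseqP.
    by have [_] := finite_dim_subspace_linear (fdQ _ thT); apply.
  by apply/funext => k; rewrite !fct_sumE mulr_sumr -big_split.
(* A single generator is a sum whose other components are zero. *)
- exists (fun th => if th == theta then eseq theta q else 0).
    move=> th thT'; case: eqP => [->|_]; first by exists q.
    have [Q0 _] := finite_dim_subspace_linear (fdQ _ thT').
    by exists 0.
  rewrite (bigD1_seq theta) ?fset_uniq //= eqxx big1 ?addr0 // => th.
  by move=> /negbTE ->.
- by move/kerE: ker_c; apply; apply: annS annf.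
Qed.

End DirectSum.

(** * Expanding matrices and coset representatives *)

(** A singular matrix would have the eigenvalue 0, whose modulus is not above 1. *)
Lemma expanding_det_neq0 (R : realType) (s : nat) (Xi : 'M[int]_s) :
  expanding R Xi -> \det Xi != 0.
Proof.
move=> expXi; apply/eqP => det0.
have : \det (map_mx intr Xi : 'M[R[i]]_s) == 0 by rewrite det_map_mx det0.
move=> /det0P[v v0 vXi0]; suff : 1 < `|0 : R[i]| by rewrite normr0 ltr10.
by apply: expXi; apply/eigenvalueP; exists v; rewrite ?scale0r.
Qed.

(** Multiplying by the adjugate stays over the integers and leaves a nonzero scalar to cancel. *)
Lemma mulmx_int_inj (s : nat) (Xi : 'M[int]_s) :
  \det Xi != 0 -> injective (mulmx Xi : 'cV[int]_s -> 'cV[int]_s).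
Proof.
move=> det0 x y /(congr1 (mulmx (\adj Xi))).
rewrite !mulmxA mul_adj_mx !mul_scalar_mx => eq_xy; apply/matrixP => i j.
by apply: (mulfI det0); move/matrixP: eq_xy => /(_ i j); rewrite !mxE.
Qed.

(** Over the reals, Xi^-1 beta splits into coordinatewise floors, which form gamma, and fractional
    parts in [0,1), whose image under [Xi] is xi. *)
Lemma E_set_cover (R : realType) (s : nat) (Xi : 'M[int]_s) :
  \det Xi != 0 -> forall beta,
  exists2 xi, E_set R Xi xi & exists gamma, beta = xi + Xi *m gamma.
Proof.
move=> det0 beta; pose A : 'M[R]_s := map_mx intr Xi.
have unitA : A \in unitmx by rewrite unitmxE det_map_mx unitfE intr_eq0.
pose y := invmx A *m map_mx intr beta.
pose gamma : 'cV[int]_s := \col_j Num.floor (y j 0).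
exists (beta - Xi *m gamma); last by exists gamma; rewrite subrK.
exists (y - map_mx intr gamma).
  move=> j; rewrite (_ : _ j 0 = y j 0 - (Num.floor (y j 0))%:~R); last first.
    rewrite mxE; congr (_ + _); rewrite mxE; congr (- _).
    by rewrite mxE; congr _%:~R; rewrite mxE.
  by rewrite subr_ge0 floor_le ltrBlDl -(intrD _ _ 1) floorD1_gt.
by rewrite map_mxB map_mxM mulmxBr mulKVmx.
Qed.

Theorem corollary3p1 (R : realType) (s : nat) (Xi : 'M[int]_s)
    (a : 'cV[int]_s -> R[i])
    (Theta : {fset 'cV[R[i]]_s})
    (Q : 'cV[R[i]]_s -> set {mpoly R[i][s]}) :
  expanding R Xi ->
  finitely_supported a ->
  zero_dim_with (ideal_gen [set subsymbol Xi a xi | xi in E_set R Xi])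
    Theta Q ->
  is_direct_sum Theta
    (fun theta => exp_poly theta (Pspace theta (Q theta)))
    (ker_subdivision Xi a).
Proof.
move=> expXi fin_a zdJ; have det0 := expanding_det_neq0 expXi.
apply: ker_subdivision_direct_sum fin_a zdJ.
- exact: pchar_num.
- exact: mulmx_int_inj.
- exact: E_set_cover.
Qed.
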